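(* Let $M$ be the complement of the figure eight knot, let $\Gamma=\pi_1(M)$ and let $\rho:\Gamma\to\mathbf{PU}(2,1)$ be the holonomy representation, given on the face-pairing generators by $\rho(g_i)=[G_i]$, $i=1,2,3$, where $g_i$ and $G_i$ are as described in the context. Then the restriction of $\rho$ to the fundamental group of the boundary torus (the link of the ideal vertex of $M$), i.e. to the peripheral subgroup isomorphic to $\mathbb{Z}^2$ generated by $h_1=g_1^{-1}g_3g_1^{-1}g_2g_3^{-1}g_1g_3^{-1}$ and $h_2=g_2^{-1}g_1$, is faithful (injective) and parabolic (every nontrivial element of the peripheral subgroup is mapped to a parabolic element of $\mathbf{PU}(2,1)$).
   Context: $\mathbf{PU}(2,1)$ is the projective unitary group of the Hermitian form $\langle z,w\rangle = z_1\overline{w}_3+z_2\overline{w}_2+z_3\overline{w}_1$ on $\mathbb{C}^3$. An element is parabolic if it has no fixed point in complex hyperbolic space $\mathbf{H}^2_{\mathbb C}$ (the projectivization of the negative vectors) and exactly one fixed point on $\partial\mathbf{H}^2_{\mathbb C}$ (the projectivization of the nonzero null vectors). $M$ is obtained from two ideal tetrahedra with vertices $p_1,p_2,q_1,q_2$ and $p_1,p_2,q_2,q_3$, sharing the face $(p_1,p_2,q_2)$, by the face pairings (written as maps of ordered triples of vertices) $$g_1:(q_2,q_1,p_1)\to(q_3,p_2,p_1),\quad g_2:(p_2,q_1,q_2)\to(p_1,q_2,q_3),\quad g_3:(q_1,p_2,p_1)\to(q_2,p_2,q_3).$$ These generate $\Gamma$; the edge cycles give the presentation $\Gamma=\langle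 g_1,g_2,g_3\mid g_2^{-1}g_3g_1^{-1}g_3^{-1}g_1=1,\ g_2g_3^{-1}g_2^{-1}g_1=1\rangle$. All ideal vertices are identified to one, whose link is a torus. With $\omega=e^{-i\pi/3}$, the holonomy matrices, which lie in $SU(2,1)$ with entries in $\mathbb{Z}[\omega]$, are $$G_1=\begin{bmatrix}1&\omega&-\omega\\0&1&-\bar\omega\\0&0&1\end{bmatrix},\quad G_2=\begin{bmatrix}1&1&-\omega\\-1&0&-\bar\omega\\-\bar\omega&\omega&1\end{bmatrix},\quad G_3=\begin{bmatrix}1&1&-\omega\\-\omega&\bar\omega&-1-\bar\omega\\-\bar\omega&0&1+\omega\end{bmatrix},$$ and $[G_i]$ denotes the class of $G_i$ in $\mathbf{PU}(2,1)$. *)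

(* Defs.v *)
From HB Require Import structures.
From mathcomp Require Import all_boot all_order all_algebra.
From mathcomp Require Import all_classical all_reals all_analysis.
From mathcomp Require Import complex.
From mathcomp Require Import ring lra.

Set Implicit Arguments.
Unset Strict Implicit.
Unset Printing Implicit Defensive.

Import Order.TTheory GRing.Theory Num.Theory.
Import numFieldNormedType.Exports.

Local Open Scope classical_set_scope.
Local Open Scope group_scope.
Local Open Scope quotient_scope.

(* [(s, true)] is the letter s and [(s, false)] its formal inverse. *)
Notation word S := (seq (S * bool)).

Section Presented.
Variables (S : choiceType) (rels : set (word S)).
Implicit Types (u v w r : word S) (a : S * bool).

Definition linv a : S * bool := (a.1, ~~ a.2).
Definition winv w : word S := rev (map linv w).

Inductive word_eq : word S -> word S -> Prop :=
| word_eq_refl u : word_eq u u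
| word_eq_sym u v : word_eq u v -> word_eq v u
| word_eq_trans v u w : word_eq u v -> word_eq v w -> word_eq u w
| word_eq_cancel u a v : word_eq (u ++ [:: a; linv a] ++ v) (u ++ v)
| word_eq_rel u r v : rels r -> word_eq (u ++ r ++ v) (u ++ v).

Definition word_eqb : rel (word S) := fun u v => `[< word_eq u v >].

Lemma word_eqb_equiv : equiv_class_of word_eqb.
Proof.
split.
- by move=> u; apply/asboolP; exact: word_eq_refl.
- by move=> u v; apply/asboolP/asboolP; exact: word_eq_sym.
- move=> v u w /asboolP uv /asboolP vw; apply/asboolP.
  exact: word_eq_trans uv vw.
Qed.
Canonical word_eqb_equiv_rel := EquivRelPack word_eqb_equiv.

Definition presented := {eq_quot word_eqb}.
HB.instance Definition _ := Choice.on presented.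
HB.instance Definition _ := EqQuotient.on presented.

Lemma presented_eqP u v :
  reflect (word_eq u v) (\pi_presented u == \pi_presented v).
Proof. by rewrite [X in reflect _ X]eqmodE; exact: asboolP. Qed.

Lemma word_eq_catl w u v : word_eq u v -> word_eq (w ++ u) (w ++ v).
Proof.
elim=> [x|x y _|x y z _ + _|x a y|x r y rr].
- exact: word_eq_refl.
- exact: word_eq_sym.
- exact: word_eq_trans.
- by rewrite [in w ++ x ++ _]catA [w ++ x ++ y]catA; exact: word_eq_cancel.
- by rewrite [in w ++ x ++ _]catA [w ++ x ++ y]catA; exact: word_eq_rel.
Qed.

Lemma word_eq_catr w u v : word_eq u v -> word_eq (u ++ w) (v ++ w).
Proof.
elim=> [x|x y _|x y z _ + _|x a y|x r y rr].
- exact: word_eq_refl.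
- exact: word_eq_sym.
- exact: word_eq_trans.
- by rewrite -!catA; exact: word_eq_cancel.
- by rewrite -!catA; exact: word_eq_rel.
Qed.

Lemma winv_cons a w : winv (a :: w) = winv w ++ [:: linv a].
Proof. by rewrite /winv /= rev_cons cats1. Qed.

Lemma word_eq_mulV w : word_eq (w ++ winv w) [::].
Proof.
elim: w => [|a w IH]; first exact: word_eq_refl.
rewrite winv_cons catA -cat1s -catA.
apply: word_eq_trans (word_eq_cancel [::] a [::]).
rewrite -catA; apply: (@word_eq_catl [:: a]).
by rewrite catA; exact: (word_eq_catr _ IH).
Qed.

Lemma linvK : involutive linv.
Proof. by case=> s b; rewrite /linv /= negbK. Qed.

Lemma winvK : involutive winv.
Proof.
by move=> w; rewrite /winv map_rev revK -map_comp (eq_map linvK) map_id.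
Qed.

Lemma winv_cat u v : winv (u ++ v) = winv v ++ winv u.
Proof. by rewrite /winv map_cat rev_cat. Qed.

Lemma word_eq_Vmul w : word_eq (winv w ++ w) [::].
Proof. by rewrite -{2}[w]winvK; exact: word_eq_mulV. Qed.

Lemma word_eq_inv u v : word_eq u v -> word_eq (winv u) (winv v).
Proof.
move=> uv.
apply: (@word_eq_trans (winv u ++ v ++ winv v)).
  apply: word_eq_sym; rewrite -[X in word_eq _ X]cats0.
  by apply: word_eq_catl; exact: word_eq_mulV.
rewrite catA -[X in word_eq _ X]cat0s; apply: word_eq_catr.
apply: word_eq_trans (word_eq_Vmul u).
by apply: word_eq_catl; exact: word_eq_sym.
Qed.

Definition presented_one : presented := \pi_presented [::].
Definition presented_mul (x y : presented) : presented := \pi_presented (repr x ++ repr y).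
Definition presented_inv (x : presented) : presented := \pi_presented (winv (repr x)).

Lemma presented_mulE u v :
  presented_mul (\pi u) (\pi v) = \pi_presented (u ++ v).
Proof.
have H w : word_eq (repr (\pi_presented w)) w.
  by apply/presented_eqP; rewrite reprK.
apply/eqP/presented_eqP.
exact: word_eq_trans (word_eq_catr _ (H u)) (word_eq_catl _ (H v)).
Qed.

Lemma presented_invE u : presented_inv (\pi u) = \pi_presented (winv u).
Proof.
apply/eqP/presented_eqP/word_eq_inv.
by apply/presented_eqP; rewrite reprK.
Qed.

Lemma presented_mulA : associative presented_mul.
Proof.
move=> x y z; rewrite -[x]reprK -[y]reprK -[z]reprK.
by rewrite !presented_mulE catA.
Qed.
Lemma presented_mul1 : left_id presented_one presented_mul.
Proof. by move=> x; rewrite -[x]reprK presented_mulE. Qed.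
Lemma presented_mulr1 : right_id presented_one presented_mul.
Proof. by move=> x; rewrite -[x]reprK presented_mulE cats0. Qed.
Lemma presented_mulV : left_inverse presented_one presented_inv presented_mul.
Proof.
move=> x; rewrite -[x]reprK presented_invE presented_mulE.
by apply/eqP/presented_eqP; exact: word_eq_Vmul.
Qed.
Lemma presented_mulrV : right_inverse presented_one presented_inv presented_mul.
Proof.
move=> x; rewrite -[x]reprK presented_invE presented_mulE.
by apply/eqP/presented_eqP; exact: word_eq_mulV.
Qed.

HB.instance Definition _ := isGroup.Build presented
  presented_mulA presented_mul1 presented_mulr1 presented_mulV presented_mulrV.

Definition presented_gen (s : S) : presented := \pi_presented [:: (s, true)].

Section Eval.
Variables (G : groupType) (f : S -> G).
Definition eval_letter a : G := if a.2 then f a.1 else (f a.1)^-1.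
Definition eval_word w : G := foldr (fun a x => eval_letter a * x) 1 w.

Lemma eval_word_cat u v : eval_word (u ++ v) = eval_word u * eval_word v.
Proof. by elim: u => [|a u IH] /=; rewrite ?mul1g// IH mulgA. Qed.

Lemma eval_word_eq u v : (forall r, rels r -> eval_word r = 1) ->
  word_eq u v -> eval_word u = eval_word v.
Proof.
move=> fr; elim=> //= [x y z _ -> //|x [s b] y|x r y rr].
  rewrite !eval_word_cat /= /eval_letter/=.
  by case: b => /=; rewrite ?mulgA ?mulgK ?mulgVK.
by rewrite !eval_word_cat (fr _ rr) mul1g.
Qed.

Lemma presented_hom : (forall r, rels r -> eval_word r = 1) ->
  exists phi : {multiplicative presented -> G},
    forall s, phi (presented_gen s) = f s.
Proof.
move=> fr; pose phi (x : presented) : G := eval_word (repr x).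
have phiE w : phi (\pi w) = eval_word w.
  by apply: eval_word_eq => //; apply/presented_eqP; rewrite reprK.
have phiM : {morph phi : x y / x * y}.
  move=> x y; rewrite -[x]reprK -[y]reprK.
  by rewrite [_ * _]presented_mulE !phiE eval_word_cat.
pose m := isMultiplicative.Build _ _ phi phiM.
pose F : {multiplicative presented -> G} := HB.pack phi m.
exists F => s /=.
by rewrite phiE /= mulg1.
Qed.
End Eval.
End Presented.

Arguments presented_gen {S} rels s.

Definition generated (G : groupType) (A : set G) : set G :=
  smallest (fun H : set G => group_closed [in H]) A.

Definition free_abelian_of_rank2 (G : groupType) (H : set G) :=
  exists phi : int * int -> G,
    [/\ {morph phi : u v / (u + v)%R >-> u * v}, injective phi
      & range phi = H].

(* The fundamental group of the figure eight knot complement enters through the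
   presentation read off the edge cycles of its two-tetrahedra gluing: the
   generators are the face pairings, 0, 1, 2 : 'I_3 standing for g1, g2, g3. *)
Definition edge_relators : set (word 'I_3) :=
  let p (i : 'I_3) := (i, true) in
  let n (i : 'I_3) := (i, false) in
  [set [:: n 1%R; p 2%R; n 0%R; n 2%R; p 0%R];
       [:: p 1%R; n 2%R; n 1%R; p 0%R]].

Definition Gamma := presented edge_relators.
HB.instance Definition _ := Group.on Gamma.
HB.instance Definition _ := EqQuotient.on Gamma.

Definition face_pairing (i : 'I_3) : Gamma := presented_gen edge_relators i.

Definition g1 : Gamma := face_pairing 0%R.
Definition g2 : Gamma := face_pairing 1%R.
Definition g3 : Gamma := face_pairing 2%R.

Definition h1 : Gamma := g1^-1 * g3 * g1^-1 * g2 * g3^-1 * g1 * g3^-1.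
Definition h2 : Gamma := g2^-1 * g1.

Definition peripheral : set Gamma := generated [set h1; h2].

Lemma edge_relations :
  g2^-1 * g3 * g1^-1 * g3^-1 * g1 = 1 /\ g2 * g3^-1 * g2^-1 * g1 = 1.
Proof.
have E : forall r, edge_relators r -> \pi_Gamma r = 1.
  move=> r rr; apply/eqP/presented_eqP.
  by rewrite -[r]cats0; exact: (@word_eq_rel _ _ [::]).
have V i : (face_pairing i)^-1 = \pi_Gamma [:: (i, false)].
  by rewrite [LHS]presented_invE.
have M x y u v : x = \pi_Gamma u -> y = \pi_Gamma v -> x * y = \pi_Gamma (u ++ v).
  by move=> -> ->; exact: presented_mulE.
have P i : face_pairing i = \pi_Gamma [:: (i, true)] by [].
split.
  rewrite (M _ _ _ _ (M _ _ _ _ (M _ _ _ _ (M _ _ _ _ (V _) (P _)) (V _))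
    (V _)) (P _)).
  by apply: E; left.
rewrite (M _ _ _ _ (M _ _ _ _ (M _ _ _ _ (P _) (V _)) (V _)) (P _)).
by apply: E; right.
Qed.

Local Open Scope ring_scope.

Section ComplexHyperbolic.
Variable R : realType.
Local Notation C := R[i].
Local Notation vec := 'cV[R[i]]_3.

Definition herm (z w : vec) : C :=
  z 0 0 * (w 2 0)^* + z 1 0 * (w 1 0)^* + z 2 0 * (w 0 0)^*.

Definition preserves_herm (A : 'M[C]_3) : Prop :=
  forall z w, herm (A *m z) (A *m w) = herm z w.

Definition U21 := {A : 'M[C]_3 | `[< preserves_herm A >]}.
HB.instance Definition _ := Choice.on U21.
HB.instance Definition _ := SubType.on U21.

Lemma U21P (A : U21) : preserves_herm (val A).
Proof. exact/asboolP/(valP A). Qed.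

Definition mkU21 (A : 'M[C]_3) (hA : preserves_herm A) : U21 :=
  exist _ A (asboolT hA).

Lemma herm_nondeg z : (forall w, herm z w = 0) -> z = 0.
Proof.
move=> h; have e (k : 'I_3) := h (delta_mx k 0).
have d (i k : 'I_3) :
    ((delta_mx k 0 : vec) i 0)^* = ((i == k)%:R : C).
  by rewrite mxE eqxx andbT rmorph_nat.
apply/matrixP => i j; rewrite ord1 mxE.
case: i => [[|[|[|//]]] hi].
- move: (e 2); rewrite /herm !d /= !(mulr0, mulr1, addr0, add0r) => <-.
  by congr (z _ _); apply: val_inj.
- move: (e 1); rewrite /herm !d /= !(mulr0, mulr1, addr0, add0r) => <-.
  by congr (z _ _); apply: val_inj.
- move: (e 0); rewrite /herm !d /= !(mulr0, mulr1, addr0, add0r) => <-.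
  by congr (z _ _); apply: val_inj.
Qed.

Lemma herm0l w : herm 0 w = 0.
Proof. by rewrite /herm !mxE !mul0r !addr0. Qed.

Lemma preserves_herm_unit A : preserves_herm A -> A \in unitmx.
Proof.
move=> hA; rewrite -unitmx_tr -row_free_unit -kermx_eq0.
apply/eqP/row_matrixP => i; rewrite row0; apply: trmx_inj; rewrite trmx0.
apply: herm_nondeg => w; rewrite -hA.
have -> : A *m (row i (kermx A^T))^T = 0.
  by apply: trmx_inj; rewrite trmx_mul trmxK trmx0 -row_mul mulmx_ker row0.
exact: herm0l.
Qed.

Lemma preserves_herm1 : preserves_herm 1%:M.
Proof. by move=> z w; rewrite !mul1mx. Qed.

Lemma preserves_hermM A B :
  preserves_herm A -> preserves_herm B -> preserves_herm (A *m B).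
Proof. by move=> hA hB z w; rewrite -!mulmxA hA hB. Qed.

Lemma preserves_hermV A : preserves_herm A -> preserves_herm (invmx A).
Proof.
move=> hA z w; have Au := preserves_herm_unit hA.
by rewrite -[LHS]hA !mulKVmx.
Qed.

Definition U21_one : U21 := mkU21 preserves_herm1.
Definition U21_mul (A B : U21) : U21 := mkU21 (preserves_hermM (U21P A) (U21P B)).
Definition U21_inv (A : U21) : U21 := mkU21 (preserves_hermV (U21P A)).

Lemma U21_mulA : associative U21_mul.
Proof. by move=> A B D; apply: val_inj; rewrite /= mulmxA. Qed.
Lemma U21_mul1 : left_id U21_one U21_mul.
Proof. by move=> A; apply: val_inj; rewrite /= mul1mx. Qed.
Lemma U21_mulr1 : right_id U21_one U21_mul.
Proof. by move=> A; apply: val_inj; rewrite /= mulmx1. Qed.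
Lemma U21_mulV : left_inverse U21_one U21_inv U21_mul.
Proof.
move=> A; apply: val_inj; rewrite /= mulVmx//.
exact/preserves_herm_unit/U21P.
Qed.
Lemma U21_mulrV : right_inverse U21_one U21_inv U21_mul.
Proof.
move=> A; apply: val_inj; rewrite /= mulmxV//.
exact/preserves_herm_unit/U21P.
Qed.

HB.instance Definition _ := isGroup.Build U21
  U21_mulA U21_mul1 U21_mulr1 U21_mulV U21_mulrV.

(* Projective equivalence; the scalar c automatically has modulus 1. *)
Definition proj_eq : rel U21 :=
  fun A B => `[< exists2 c : C, c != 0 & val A = c *: val B >].

Lemma proj_eq_equiv : equiv_class_of proj_eq.
Proof.
split.
- by move=> A; apply/asboolP; exists 1; rewrite ?oner_eq0 ?scale1r.
- have s A B : proj_eq A B -> proj_eq B A.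
    move=> /asboolP[c c0 AB]; apply/asboolP; exists c^-1; rewrite ?invr_eq0//.
    by rewrite AB scalerA mulVf// scale1r.
  by move=> A B; apply/idP/idP; exact: s.
- move=> B A D /asboolP[c c0 AB] /asboolP[d d0 BD]; apply/asboolP.
  by exists (c * d); rewrite ?mulf_neq0// AB BD scalerA.
Qed.
Canonical proj_eq_equiv_rel := EquivRelPack proj_eq_equiv.

Definition PU21 := {eq_quot proj_eq}.
HB.instance Definition _ := Choice.on PU21.
HB.instance Definition _ := EqQuotient.on PU21.

Lemma PU21_eqP (A B : U21) :
  reflect (exists2 c : C, c != 0 & val A = c *: val B)
          (\pi_PU21 A == \pi_PU21 B).
Proof. by rewrite [X in reflect _ X]eqmodE; exact: asboolP. Qed.

Lemma PU21_repr (A : U21) :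
  exists2 c : C, c != 0 & val (repr (\pi_PU21 A)) = c *: val A.
Proof. by apply/PU21_eqP; rewrite reprK. Qed.

Definition PU21_one : PU21 := \pi_PU21 (1%g : U21).
Definition PU21_mul (x y : PU21) : PU21 := \pi_PU21 (repr x * repr y)%g.
Definition PU21_inv (x : PU21) : PU21 := \pi_PU21 ((repr x)^-1)%g.

Lemma PU21_mulE A B : PU21_mul (\pi A) (\pi B) = \pi_PU21 (A * B)%g.
Proof.
apply/eqP/PU21_eqP; have [c c0 cE] := PU21_repr A; have [d d0 dE] := PU21_repr B.
exists (c * d); rewrite ?mulf_neq0//=.
by rewrite cE dE -scalemxAl -scalemxAr scalerA.
Qed.

Lemma PU21_invE A : PU21_inv (\pi A) = \pi_PU21 (A^-1)%g.
Proof.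
apply/eqP/PU21_eqP; have [c c0 cE] := PU21_repr A.
exists c^-1; rewrite ?invr_eq0//= cE invmxZ//.
by rewrite -cE; exact/preserves_herm_unit/U21P.
Qed.

Lemma PU21_mulA : associative PU21_mul.
Proof.
move=> x y z; rewrite -[x]reprK -[y]reprK -[z]reprK.
by rewrite !PU21_mulE mulgA.
Qed.
Lemma PU21_mul1 : left_id PU21_one PU21_mul.
Proof. by move=> x; rewrite -[x]reprK PU21_mulE mul1g. Qed.
Lemma PU21_mulr1 : right_id PU21_one PU21_mul.
Proof. by move=> x; rewrite -[x]reprK PU21_mulE mulg1. Qed.
Lemma PU21_mulV : left_inverse PU21_one PU21_inv PU21_mul.
Proof. by move=> x; rewrite -[x]reprK PU21_invE PU21_mulE mulVg. Qed.
Lemma PU21_mulrV : right_inverse PU21_one PU21_inv PU21_mul.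
Proof. by move=> x; rewrite -[x]reprK PU21_invE PU21_mulE mulgV. Qed.

HB.instance Definition _ := isGroup.Build PU21
  PU21_mulA PU21_mul1 PU21_mulr1 PU21_mulV PU21_mulrV.

(* Points of the complex projective plane are the lines <[z]> of C^3, for z
   nonzero; an element of PU(2,1) acts on them through any of its lifts. *)
Definition mxact (A : 'M[C]_3) (L : {vspace vec}) : {vspace vec} :=
  (linfun (mulmx A) @: L)%VS.

Definition PUact (g : PU21) (L : {vspace vec}) : {vspace vec} :=
  mxact (val (repr g)) L.

Lemma mxact_line A (z : vec) : mxact A <[z]>%VS = <[A *m z]>%VS.
Proof. by rewrite /mxact limg_line lfunE. Qed.

Lemma mxactZ (c : C) A L : c != 0 -> mxact (c *: A) L = mxact A L.
Proof.
move=> c0; have s B d : (mxact (d *: B) L <= mxact B L)%VS.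
  apply/subvP => _ /memv_imgP[z zL ->]; rewrite lfunE /= -scalemxAl.
  by rewrite memvZ//; apply/memv_imgP; exists z => //; rewrite lfunE.
apply/eqP; rewrite eqEsubv s /=.
by rewrite -{1}[A](scale1r) -(mulVf c0) -scalerA s.
Qed.

Lemma PUactE (A : U21) L : PUact (\pi A) L = mxact (val A) L.
Proof. by rewrite /PUact; have [c c0 ->] := PU21_repr A; rewrite mxactZ. Qed.

(* [herm z z] is real, and [x < 0] in C means that x is real and negative. *)
Definition H2C : set {vspace vec} :=
  [set L | exists2 z, herm z z < 0 & L = <[z]>%VS].

Definition boundary_H2C : set {vspace vec} :=
  [set L | exists z, [/\ z != 0, herm z z = 0 & L = <[z]>%VS]].

Definition parabolic (g : PU21) : Prop :=
  ~ (exists2 L, H2C L & PUact g L = L) /\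
  exists! L, boundary_H2C L /\ PUact g L = L.

End ComplexHyperbolic.

Section Holonomy.
Variable R : realType.
Local Notation C := R[i].

Definition omega : C := (cos (- (pi / 3)) +i* sin (- (pi / 3)))%C.
Local Notation w := omega.
Local Notation w' := (omega^*).

Definition mx3 (s : seq (seq C)) : 'M[C]_3 := \matrix_(i, j) (nth [::] s i)`_j.

Definition G1_mx : 'M[C]_3 :=
  mx3 [:: [:: 1;  w; - w ];
          [:: 0;  1; - w'];
          [:: 0;  0;   1 ]].

Definition G2_mx : 'M[C]_3 :=
  mx3 [:: [::    1; 1; - w ];
          [::  - 1; 0; - w'];
          [:: - w'; w;   1 ]].

Definition G3_mx : 'M[C]_3 :=
  mx3 [:: [::    1;  1;     - w  ];
          [::  - w; w'; - 1 - w' ];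
          [:: - w';  0;   1 + w  ]].

Lemma cos_pi3 : cos (pi / 3) = 1 / 2 :> R.
Proof.
set x := pi / 3; have x3 : x *+ 2 + x = pi :> R by rewrite /x; field.
have h : cos x ^+ 2 + sin x ^+ 2 = 1 by exact: cos2Dsin2.
have c : cos x > 0.
  by apply: cos_gt0_pihalf; have := @pi_gt0 R; rewrite /x => ?; apply/andP; split; lra.
have := cosD (x *+ 2) x; rewrite x3 cospi cos_mulr2n sin_mulr2n => e.
have e' : (cos x + 1) * (2 * cos x - 1) ^+ 2 = 0.
  have s2 : sin x ^+ 2 = 1 - cos x ^+ 2 by lra.
  have e1 : -1 = 4 * cos x ^+ 3 - 3 * cos x by rewrite e; ring: s2.
  have -> : (cos x + 1) * (2 * cos x - 1) ^+ 2 = 4 * cos x ^+ 3 - 3 * cos x + 1.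
    by ring.
  by rewrite -e1; ring.
move/eqP: e'; rewrite mulf_eq0 expf_eq0 /= => /orP[/eqP|/eqP]; lra.
Qed.

Lemma omega_conj : w' = 1 - w.
Proof.
have -> : w' = (cos (- (pi / 3)) -i* sin (- (pi / 3)))%C by [].
rewrite /omega cosN cos_pi3; apply/eqP; rewrite eq_complex /=.
by apply/andP; split; apply/eqP; lra.
Qed.

Lemma omega2 : w ^+ 2 = w - 1.
Proof.
rewrite expr2 /omega cosN cos_pi3.
have := cos2Dsin2 (- (pi / 3) : R); rewrite cosN cos_pi3 => h.
apply/eqP; rewrite eq_complex /=.
by apply/andP; split; apply/eqP; lra.
Qed.

Lemma mulmx3E (A : 'M[C]_3) (z : 'cV[C]_3) i :
  (A *m z) i 0 = A i 0 * z 0 0 + A i 1 * z 1 0 + A i 2 * z 2 0.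
Proof.
rewrite mxE !big_ord_recl big_ord0 addr0 addrA.
by congr (_ + _ + _); congr (A _ _ * z _ _); apply: val_inj.
Qed.

Lemma G1_preserves : preserves_herm G1_mx.
Proof.
move=> z v; rewrite /herm !mulmx3E !mxE /=.
rewrite !(rmorphD, rmorphM, rmorphN, rmorph1, rmorph0) /= ?conjCK omega_conj.
by ring: omega2.
Qed.

Lemma G2_preserves : preserves_herm G2_mx.
Proof.
move=> z v; rewrite /herm !mulmx3E !mxE /=.
rewrite !(rmorphD, rmorphM, rmorphN, rmorph1, rmorph0) /= ?conjCK omega_conj.
by ring: omega2.
Qed.

Lemma G3_preserves : preserves_herm G3_mx.
Proof.
move=> z v; rewrite /herm !mulmx3E !mxE /=.
rewrite !(rmorphD, rmorphM, rmorphN, rmorph1, rmorph0) /= ?conjCK omega_conj.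
by ring: omega2.
Qed.

Definition G1 : U21 R := mkU21 G1_preserves.
Definition G2 : U21 R := mkU21 G2_preserves.
Definition G3 : U21 R := mkU21 G3_preserves.

Lemma mulmx_mx3 a00 a01 a02 a10 a11 a12 a20 a21 a22
  b00 b01 b02 b10 b11 b12 b20 b21 b22 :
  mx3 [:: [:: a00; a01; a02]; [:: a10; a11; a12]; [:: a20; a21; a22]] *m
  mx3 [:: [:: b00; b01; b02]; [:: b10; b11; b12]; [:: b20; b21; b22]] =
  mx3 [:: [:: a00 * b00 + a01 * b10 + a02 * b20; a00 * b01 + a01 * b11 + a02 * b21; a00 * b02 + a01 * b12 + a02 * b22];
            [:: a10 * b00 + a11 * b10 + a12 * b20; a10 * b01 + a11 * b11 + a12 * b21; a10 * b02 + a11 * b12 + a12 * b22];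
            [:: a20 * b00 + a21 * b10 + a22 * b20; a20 * b01 + a21 * b11 + a22 * b21; a20 * b02 + a21 * b12 + a22 * b22]].
Proof.
apply/matrixP => i j; rewrite !mxE !big_ord_recl big_ord0 addr0 addrA !mxE.
case: i => [[|[|[|i]]] hi]; last by have := hi.
all: by case: j => [[|[|[|j]]] hj]; last by have := hj.
Qed.

Lemma mx3_1 : 1%:M = mx3 [:: [:: 1; 0; 0]; [:: 0; 1; 0]; [:: 0; 0; 1]].
Proof.
apply/matrixP => i j; rewrite !mxE.
case: i => [[|[|[|i]]] hi]; last by have := hi.
all: by case: j => [[|[|[|j]]] hj]; last by have := hj.
Qed.

Local Ltac mx3_eq :=
  let e := fresh "e" in
  rewrite ?mx3_1 ?mulmx_mx3 ?omega_conj; move: (w) omega2 => ? e;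
  do 2 f_equal; [| f_equal; [| f_equal]]; do 3 (f_equal; try by ring: e).

Lemma G12_G23 : (G1 * G2 = G2 * G3)%g.
Proof.
apply: val_inj.
rewrite -[LHS]/(G1_mx *m G2_mx) -[RHS]/(G2_mx *m G3_mx).
rewrite /G1_mx /G2_mx /G3_mx.
by mx3_eq.
Qed.

Let G1V : 'M[C]_3 := mx3 [:: [:: 1; - w; - w']; [:: 0; 1; w']; [:: 0; 0; 1]].

Lemma G1VE : val (G1^-1)%g = G1V.
Proof.
have e : G1_mx *m G1V = 1%:M by rewrite /G1_mx /G1V; mx3_eq.
have u : G1_mx \in unitmx by exact: preserves_herm_unit G1_preserves.
by rewrite -[LHS]mulmx1 -e mulKmx.
Qed.

Lemma G213_G31 : (G2 * G1^-1 * G3 = G3 * G1^-1)%g.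
Proof.
apply: val_inj; rewrite -[LHS]/(G2_mx *m val (G1^-1)%g *m G3_mx).
rewrite -[RHS]/(G3_mx *m val (G1^-1)%g) G1VE /G2_mx /G3_mx /G1V.
by mx3_eq.
Qed.

Definition PUclass (A : U21 R) : PU21 R := \pi_(PU21 R) A.

Lemma PUclassM : {morph PUclass : A B / (A * B)%g}.
Proof. by move=> A B; rewrite [RHS]PU21_mulE. Qed.

Lemma PUclassV : {morph PUclass : A / A^-1%g}.
Proof. by move=> A; rewrite [RHS]PU21_invE. Qed.

Lemma holonomy_exists : exists rho : {multiplicative Gamma -> PU21 R},
  [/\ rho g1 = PUclass G1, rho g2 = PUclass G2 & rho g3 = PUclass G3].
Proof.
pose f (i : 'I_3) := nth (PUclass 1%g) [:: PUclass G1; PUclass G2; PUclass G3] i.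
have [|rho rhoE] := @presented_hom _ edge_relators _ f; last first.
  by exists rho; split; exact: rhoE.
have one : PUclass 1%g = 1%g by [].
move=> r [->|->]; rewrite /eval_word /eval_letter /= /f /= mulg1.
  transitivity (PUclass (G2^-1 * (G3 * (G1^-1 * (G3^-1 * G1))))%g).
    by rewrite !PUclassM !PUclassV.
  rewrite -one; congr PUclass.
  by rewrite [(G3 * _)%g]mulgA -G213_G31 !mulgA mulVg mul1g mulgK mulVg.
transitivity (PUclass (G2 * (G3^-1 * (G2^-1 * G1)))%g).
  by rewrite !PUclassM !PUclassV.
rewrite -one; congr PUclass.
have -> : (G3^-1 * (G2^-1 * G1) = (G2 * G3)^-1 * G1)%g by rewrite invgM mulgA.
by rewrite -G12_G23 invgM !mulgA mulgV mul1g mulVg.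
Qed.

End Holonomy.

(* Main.v *)
Require Import Defs.
From mathcomp Require Import all_boot all_order all_algebra.
From mathcomp Require Import all_classical all_reals all_analysis.
From mathcomp Require Import complex.
From mathcomp Require Import zify ring.

(* The edge relations give h1 h2 = h2 h1, and both rho h1 and rho h2 are classes
   of lower unitriangular matrices heis k t, where heis turns sums of pairs
   (k, t) into products: h1 goes to (-2, -2) and h2 to (1, -1). These vectors
   are independent, so every nontrivial h1^a h2^b goes to some heis k t with
   (k, t) <> 0. Such a Heisenberg translation fixes <[e3]>, and any other line
   it fixes lies in the plane z1 = 0, on which the form is |z2|^2; hence it is
   parabolic. As the identity is not parabolic, (a, b) |-> rho (h1^a h2^b) is
   injective, so the peripheral group is free abelian and rho is faithful on it. *)

Import Order.TTheory GRing.Theory Num.Theory.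

(** * Integer powers and subgroups generated by two commuting elements *)

Section IntegerPowers.
Local Open Scope group_scope.
Variable G : groupType.
Implicit Types (x y : G) (n m : int).

Definition expgz x n : G :=
  match n with Posz k => x ^+ k | Negz k => x ^- k.+1 end.

Lemma expgzS x n : expgz x (n + 1)%R = expgz x n * x.
Proof.
case: n => [k|[|k]].
- by rewrite -PoszD addn1 /= expgSr.
- by rewrite /= mulVg.
- have -> : (Negz k.+1 + 1 = Negz k)%R by lia.
  by rewrite /= [in RHS]expgS invgM mulgVK.
Qed.

Lemma expgzB1 x n : expgz x (n - 1)%R = expgz x n * x^-1.
Proof. by rewrite -[in RHS](subrK 1%R n) expgzS mulgK. Qed.

Lemma expgzD x n m : expgz x (n + m)%R = expgz x n * expgz x m.
Proof.
elim: m => [|m IH|m IH]; first by rewrite addr0 mulg1.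
- by rewrite -[m.+1]addn1 PoszD addrA !expgzS IH mulgA.
- have -> : (- m.+1%:Z = - m%:Z - 1)%R by lia.
  by rewrite addrA !expgzB1 IH mulgA.
Qed.

Lemma commute_expgz x y n : commute x y -> commute x (expgz y n).
Proof.
case: n => k xy; first exact: commuteX.
exact/commuteV/commuteX.
Qed.

Lemma commute_expgz2 x y n m : commute x y -> commute (expgz x n) (expgz y m).
Proof. by move=> xy; apply/commute_expgz/commute_sym/commute_expgz. Qed.

(** For commuting [x] and [y], the homomorphism from Z^2 that parametrizes the subgroup they
    generate. *)
Definition expgz2 x y (u : int * int) : G := expgz x u.1 * expgz y u.2.

Lemma expgz2D x y : commute x y ->
  {morph expgz2 x y : u v / (u + v)%R >-> u * v}.
Proof.
move=> xy [a b] [c d]; rewrite /expgz2 /= !expgzD.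
by rewrite !mulgA -[_ * _ * expgz x c]mulgA -(commute_expgz2 _ _ _ _ xy) !mulgA.
Qed.

Lemma expgz2N x y : commute x y ->
  {morph expgz2 x y : u / (- u)%R >-> u^-1}.
Proof.
move=> xy u; apply: (mulgI (expgz2 x y u)).
by rewrite -expgz2D// subrr mulgV /expgz2 mulg1.
Qed.

Lemma group_closed_expgz (H : set G) x n :
  group_closed [in H] -> x \in H -> expgz x n \in H.
Proof.
move=> HG xH; have HV := group_closedV HG.
have [H1 _] := HG; have HM := group_closedM HG.
have HX k : x ^+ k \in H.
  by elim: k => [|k IH]; [exact: H1 | rewrite expgS; exact: HM].
by case: n => k; [exact: HX | exact/HV/HX].
Qed.

(** Commutativity makes these products closed under division, so they form a subgroup; any subgroup
    containing [x] and [y] contains them. *)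
Lemma range_expgz2 x y : commute x y ->
  range (expgz2 x y) = generated [set x; y]%classic.
Proof.
move=> xy; apply/seteqP; split.
  move=> _ [u _ <-] H [HG Hxy]; apply/set_mem.
  by apply: (group_closedM HG); apply: group_closed_expgz => //;
    apply/mem_set/Hxy; [left | right].
apply: smallest_sub.
  split=> [|a b]; first by apply/mem_set; exists 0%R; rewrite // /expgz2 mulg1.
  move=> /set_mem[u _ <-] /set_mem[v _ <-]; apply/mem_set.
  by exists (u - v)%R; rewrite // expgz2D// expgz2N.
move=> _ [->|->]; first by exists (1, 0)%R; rewrite // /expgz2 /= mulg1 expg1.
by exists (0, 1)%R; rewrite // /expgz2 /= mul1g expg1.
Qed.

End IntegerPowers.
Arguments expgz {G} x n.
Arguments expgz2 {G} x y u.

Section MultiplicativeMaps.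
Local Open Scope group_scope.
Variables (G H : groupType) (f : {multiplicative G -> H}).

Lemma multiplicative1 : f 1 = 1.
Proof. by apply: (mulgI (f 1)); rewrite -gmulfM !mulg1. Qed.

Lemma multiplicativeV x : f x^-1 = (f x)^-1.
Proof.
by apply: (mulgI (f x)); rewrite -gmulfM !mulgV multiplicative1.
Qed.

Lemma multiplicative_expgz x n : f (expgz x n) = expgz (f x) n.
Proof.
have fX k : f (x ^+ k) = f x ^+ k.
  by elim: k => [|k IH]; rewrite ?multiplicative1// !expgS gmulfM IH.
by case: n => k; rewrite /= ?multiplicativeV fX.
Qed.

End MultiplicativeMaps.

(** * Commutation of the two peripheral generators *)

Section Peripheral.
Local Open Scope group_scope.

(** Lets the conjugation of [h2] by the word [h1] be followed one factor at a time. *)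
Lemma semiconj_mul (G : groupType) (x y a b c : G) :
  y * a = b * y -> x * b = c * x -> x * y * a = c * (x * y).
Proof. by move=> e1 e2; rewrite -mulgA e1 mulgA e2 mulgA. Qed.

Lemma commute_h1_h2 : commute h1 h2.
Proof.
have [R1 R2] := edge_relations.
have E2 : g2 = g3 * g1^-1 * g3^-1 * g1.
  by apply: (mulgI g2^-1); rewrite mulVg !mulgA R1.
have E2V : g2^-1 = g1^-1 * g3 * g1 * g3^-1.
  by rewrite E2 !invgM !invgK !mulgA.
have E1V : g1^-1 = g2 * g3^-1 * g2^-1.
  by apply: (mulIg g1); rewrite mulVg R2.
have E1 : g1 = g2 * g3 * g2^-1 by rewrite -[LHS]invgK E1V !invgM !invgK !mulgA.
have Eh2 : h2 = g3 * g2^-1 by rewrite /h2 E1 !mulgA mulVg mul1g.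
(* The factor [g1^-1 * g2] is regrouped as [h2^-1], which conjugates [g3] to [g1] in a single
   move. *)
have -> : h1 = g1^-1 * (g3 * (h2^-1 * (g3^-1 * (g1 * g3^-1)))).
  by rewrite /h1 /h2 invgM invgK !mulgA.
(* Conjugating by the successive letters of h1, h2 becomes g2^-1 g3, then
   g3 (twice), g1, g3 g1 g3^-1 and finally h2 again. *)
apply: (semiconj_mul _ _ _ _ (g3 * g1 * g3^-1)); last first.
  by rewrite /h2 E2V !mulgA mulgK.
apply: (semiconj_mul _ _ _ _ g1); last by rewrite mulgVK.
apply: (semiconj_mul _ _ _ _ g3); last first.
  by rewrite /h2 invgM invgK mulVKg {1}E1V !mulgVK.
apply: (semiconj_mul _ _ _ _ g3); first last.
- by rewrite mulVg mulgV.
- apply: (semiconj_mul _ _ _ _ (g2^-1 * g3)); last first.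
    by rewrite E2V !mulgA mulgV mul1g mulgVK.
  by rewrite Eh2 !mulgA mulVg mul1g mulgK.
Qed.

End Peripheral.

(** * Heisenberg translations and their classes in PU(2,1) *)

Section Heisenberg.
Local Open Scope ring_scope.
Variable R : realType.
Local Notation C := R[i].
Local Notation w := (omega R).

(* The Heisenberg translations fixing e3 whose horizontal part is a real multiple
   of conj omega = 1 - omega; these commute, so (k, t) is additive. *)
Definition heis (k t : C) : 'M[C]_3 :=
  mx3 [:: [:: 1; 0; 0];
          [:: k * (1 - w); 1; 0];
          [:: (t * (2 * w - 1) - k ^+ 2) / 2; - (k * w); 1]].

Lemma eq_mx3 (a00 a01 a02 a10 a11 a12 a20 a21 a22
  b00 b01 b02 b10 b11 b12 b20 b21 b22 : C) :
  a00 = b00 -> a01 = b01 -> a02 = b02 ->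
  a10 = b10 -> a11 = b11 -> a12 = b12 ->
  a20 = b20 -> a21 = b21 -> a22 = b22 ->
  mx3 [:: [:: a00; a01; a02]; [:: a10; a11; a12]; [:: a20; a21; a22]] =
  mx3 [:: [:: b00; b01; b02]; [:: b10; b11; b12]; [:: b20; b21; b22]].
Proof. by do 9! move=> ->. Qed.

Lemma scale_mx3 (c a00 a01 a02 a10 a11 a12 a20 a21 a22 : C) :
  c *: mx3 [:: [:: a00; a01; a02]; [:: a10; a11; a12]; [:: a20; a21; a22]] =
  mx3 [:: [:: c * a00; c * a01; c * a02]; [:: c * a10; c * a11; c * a12];
            [:: c * a20; c * a21; c * a22]].
Proof.
apply/matrixP => i j; rewrite !mxE.
case: i => [[|[|[|i]]] hi]; last by have := hi.
all: by case: j => [[|[|[|j]]] hj]; last by have := hj.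
Qed.

Local Ltac mx3_field :=
  let e := fresh "e" in
  rewrite ?mx3_1 ?scale_mx3 ?mulmx_mx3 ?scale_mx3 ?omega_conj;
  move: w (omega2 R) => ? e; apply: eq_mx3; field: e.

Lemma heis0 : heis 0 0 = 1%:M.
Proof. by rewrite /heis; mx3_field. Qed.

Lemma heisD k t k' t' : heis k t *m heis k' t' = heis (k + k') (t + t').
Proof. by rewrite /heis; mx3_field. Qed.

(** As [w] is e^(-i pi/3), this number is -i sqrt 3, with square -3. *)
Lemma omega_imag_neq0 : 2 * w - 1 != 0.
Proof.
apply/eqP => e; have : (2 * w - 1) ^+ 2 = -3 by ring: (omega2 R).
by rewrite e expr0n /= => /eqP; rewrite eq_sym oppr_eq0 pnatr_eq0.
Qed.

(** If the first coordinate were nonzero, the first row would force eigenvalue 1; the second row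
    then gives [k = 0], and the third gives [t = 0]. *)
Lemma fixed_line_heis k t (z : 'cV[C]_3) : (k, t) != 0 -> z != 0 ->
  mxact (heis k t) <[z]>%VS = <[z]>%VS -> z 0 0 = 0.
Proof.
move=> kt z0; rewrite mxact_line => Lz.
have /vlineP[c zc] : heis k t *m z \in <[z]>%VS by rewrite -Lz memv_line.
apply: contraNeq kt => z00.
have E i := congr1 (fun M : 'cV[C]_3 => M i 0) zc.
move: (E 0) (E 1) (E 2); rewrite !mulmx3E !mxE /=.
rewrite !(mul1r, mul0r, addr0) => E0.
have -> : c = 1 by apply: (mulIf z00); rewrite mul1r.
(* The second row leaves [k * (1 - w) * z 0 0 = 0], and [w = 1] would contradict
   [w ^+ 2 = w - 1]. *)
rewrite !mul1r => /eqP; rewrite -subr_eq0 addrK mulf_eq0 (negPf z00) orbF.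
rewrite mulf_eq0 => /orP[|w1]; last first.
  have := omega2 R; move: w1; rewrite subr_eq0 => /eqP <-.
  by rewrite expr1n subrr => /eqP; rewrite oner_eq0.
move=> /eqP ->; rewrite !(mul0r, oppr0, expr0n, subr0, addr0) /= => /eqP.
rewrite -subr_eq0 addrK !mulf_eq0 (negPf z00) (negPf omega_imag_neq0) !orbF.
by rewrite invr_eq0 pnatr_eq0 orbF => /eqP ->.
Qed.

Definition cusp : 'cV[C]_3 := delta_mx 2 0.

Lemma heis_cusp k t : heis k t *m cusp = cusp.
Proof.
apply/matrixP => i j; rewrite ord1 mulmx3E !mxE /=.
by case: i => [[|[|[|i]]] hi] //=; rewrite !(mulr0, mulr1, add0r).
Qed.

Lemma heis_parabolic (A : U21 R) c k t : c != 0 -> val A = c *: heis k t ->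
  (k, t) != 0 -> parabolic (PUclass A).
Proof.
move=> c0 AE kt; rewrite /parabolic.
have actE L : PUact (PUclass A) L = mxact (heis k t) L.
  by rewrite PUactE AE mxactZ.
split.
  move=> [_ [z zneg ->]]; rewrite actE => zfix.
  have z0 : z != 0 by apply: contraTneq zneg => ->; rewrite herm0l ltxx.
  move: zneg; rewrite /herm (fixed_line_heis _ _ _ kt z0 zfix) conjC0.
  by rewrite mul0r mulr0 addr0 add0r le_gtF ?mul_conjC_ge0.
exists <[cusp]>%VS; split.
  split; last by rewrite actE mxact_line heis_cusp.
  exists cusp; split => //.
    apply/eqP => /matrixP/(_ 2 0); rewrite !mxE /= => /eqP.
    by rewrite oner_eq0.
  by rewrite /herm !mxE /= conjC0 !mul0r mulr0 !addr0.
move=> _ [[z [z0 znull ->]]]; rewrite actE => zfix.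
have z00 := fixed_line_heis _ _ _ kt z0 zfix.
move: znull; rewrite /herm z00 conjC0 mul0r mulr0 addr0 add0r => /eqP.
rewrite mul_conjC_eq0 => /eqP z10.
have zE : z = z 2 0 *: cusp.
  apply/matrixP => i j; rewrite ord1 !mxE /=.
  case: i => [[|[|[|i]]] hi] //=; rewrite ?(mulr0, mulr1).
  - by rewrite -z00; congr (z _ _); exact: val_inj.
  - by rewrite -z10; congr (z _ _); exact: val_inj.
  - by congr (z _ _); exact: val_inj.
(* One line contains the other's generator, and both have dimension 1. *)
apply/eqP; rewrite eq_sym eqEdim; apply/andP; split.
  by rewrite -memvE zE memvZ// memv_line.
rewrite !dim_vline z0; by case: (_ != _).
Qed.

Lemma not_parabolic1 : ~ parabolic (1%g : PU21 R).
Proof.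
move=> [noH _]; apply: noH.
(* The vector e1 - e3 has norm -2, so its line is a point of [H2C]. *)
pose z : 'cV[C]_3 := delta_mx 0 0 - delta_mx 2 0.
exists <[z]>%VS; last by rewrite PUactE mxact_line mul1mx.
exists z => //.
rewrite /herm !mxE /= !(subr0, sub0r, conjC0, conjCN1, conjC1, mul0r, addr0,
  mul1r, mulr1).
by rewrite -opprD oppr_lt0 addr_gt0.
Qed.


(** The scalar [c] is kept because a lift may be unipotent only up to a unit, as happens for
    [h1]. *)
Definition heis_class k t (g : PU21 R) : Prop :=
  exists A c, [/\ c != 0, val A = c *: heis k t & g = PUclass A].

Lemma heis_class1 : heis_class 0 0 1%g.
Proof. by exists 1%g, 1; rewrite oner_neq0 scale1r heis0. Qed.

Lemma heis_classM k t k' t' g g' : heis_class k t g -> heis_class k' t' g' ->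
  heis_class (k + k') (t + t') (g * g')%g.
Proof.
move=> [A [c [c0 AE ->]]] [B [d [d0 BE ->]]]; exists (A * B)%g, (c * d).
split; [by rewrite mulf_neq0| |by rewrite PUclassM].
rewrite -[LHS]/(val A *m val B) AE BE -scalemxAl -scalemxAr scalerA.
by rewrite heisD.
Qed.

Lemma heis_classV k t g : heis_class k t g -> heis_class (- k) (- t) g^-1%g.
Proof.
move=> [A [c [c0 AE ->]]]; exists A^-1%g, c^-1.
split; [by rewrite invr_neq0| |by rewrite PUclassV].
rewrite -[LHS]/(invmx (val A)) AE.
have e : c *: heis k t *m (c^-1 *: heis (- k) (- t)) = 1%:M.
  by rewrite -scalemxAl -scalemxAr scalerA mulfV// scale1r heisD !subrr heis0.
have [u _] := mulmx1_unit e.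
by rewrite -[LHS]mulmx1 -e mulKmx.
Qed.

Lemma heis_class_expgz k t g n : heis_class k t g ->
  heis_class (n%:~R * k) (n%:~R * t) (expgz g n).
Proof.
move=> hg; have hX m : heis_class (m%:R * k) (m%:R * t) (g ^+ m)%g.
  elim: m => [|m IH]; first by rewrite !mul0r; exact: heis_class1.
  by rewrite expgS -natr1 !mulrDl !mul1r ![_ + k]addrC ![_ + t]addrC;
    exact: heis_classM.
case: n => m; first exact: hX.
by rewrite NegzE !mulrNz !mulNr; exact/heis_classV/hX.
Qed.

Lemma heis_class_parabolic k t g : heis_class k t g -> (k, t) != 0 ->
  parabolic g.
Proof. by move=> [A [c [c0 AE ->]]]; exact: heis_parabolic AE. Qed.

Lemma heis_class_h2 : heis_class 1 (-1) (PUclass ((G2 R)^-1 * G1 R)%g).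
Proof.
exists ((G2 R)^-1 * G1 R)%g, 1; split=> //.
rewrite scale1r -[LHS]/(invmx (G2_mx R) *m G1_mx R).
(* Factoring [G1_mx] through [G2_mx] avoids computing the inverse of [G2_mx]. *)
have -> : G1_mx R = G2_mx R *m heis 1 (-1).
  by rewrite /G1_mx /G2_mx /heis; mx3_field.
by rewrite mulKmx//; exact: preserves_herm_unit (@G2_preserves R).
Qed.

(* Multiplying on the right by g3 g1^-1 g3 clears the inverses of G3. *)
Lemma heis_class_h1 : heis_class (-2) (-2) (PUclass
  ((G1 R)^-1 * G3 R * (G1 R)^-1 * G2 R * (G3 R)^-1 * G1 R * (G3 R)^-1)%g).
Proof.
(* The product has the triple eigenvalue [- w], a primitive cube root of unity, which is compatible
   with determinant 1. *)
set H := (_ * _)%g; exists H, (- w); split=> //.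
  rewrite oppr_eq0; apply/eqP => w0; have := omega2 R; rewrite w0 expr0n /=.
  by move=> /eqP; rewrite sub0r eq_sym oppr_eq0 oner_eq0.
pose X := (G3 R * ((G1 R)^-1 * G3 R))%g.
have HX : (H * X = (G1 R)^-1 * G3 R * ((G1 R)^-1 * G2 R))%g.
  by rewrite /H /X !mulgA !mulgVK mulgK mulgVK.
have uX : val X \in unitmx by exact/preserves_herm_unit/U21P.
apply: (can_inj (mulmxK uX)); rewrite -[LHS]/(val (H * X)%g) HX.
have V : val ((G1 R)^-1)%g =
    mx3 [:: [:: 1; - w; - (1 - w)]; [:: 0; 1; 1 - w]; [:: 0; 0; 1]].
  by rewrite G1VE omega_conj.
rewrite -[LHS]/(val (G1 R)^-1%g *m G3_mx R *m (val (G1 R)^-1%g *m G2_mx R)).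
rewrite -[val X]/(G3_mx R *m (val (G1 R)^-1%g *m G3_mx R)) V.
by rewrite /G2_mx /G3_mx /heis; mx3_field.
Qed.

End Heisenberg.

Theorem proposition4p3 (R : realType)
    (rho : {multiplicative Gamma -> PU21 R})
    (rho_g1 : rho g1 = PUclass (G1 R))
    (rho_g2 : rho g2 = PUclass (G2 R))
    (rho_g3 : rho g3 = PUclass (G3 R)) :
  [/\ free_abelian_of_rank2 peripheral,
      {in peripheral &, injective rho}
    & forall x, x \in peripheral -> x <> 1%g -> parabolic (rho x)].
Proof.
pose phi := expgz2 h1 h2.
have phiD : {morph phi : u v / (u + v)%R >-> (u * v)%g}.
  exact: expgz2D commute_h1_h2.
have rangeE : range phi = peripheral by exact: range_expgz2 commute_h1_h2.
have phi0 : phi 0%R = 1%g by rewrite /phi /expgz2 mulg1.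
have rho_h1 : heis_class R (-2)%R (-2)%R (rho h1).
  have -> : rho h1 = PUclass ((G1 R)^-1 * G3 R * (G1 R)^-1 * G2 R * (G3 R)^-1
      * G1 R * (G3 R)^-1)%g.
    rewrite /h1 !gmulfM !multiplicativeV rho_g1 rho_g2 rho_g3.
    by rewrite !PUclassM !PUclassV.
  exact: heis_class_h1.
have rho_h2 : heis_class R 1%R (-1)%R (rho h2).
  have -> : rho h2 = PUclass ((G2 R)^-1 * G1 R)%g.
    by rewrite /h2 gmulfM multiplicativeV rho_g1 rho_g2 PUclassM PUclassV.
  exact: heis_class_h2.
have par u : u != 0%R -> parabolic (rho (phi u)).
  case: u => a b ab; rewrite /phi /expgz2 gmulfM !multiplicative_expgz.
  apply: (heis_class_parabolic R _ _ _ (heis_classM _ _ _ _ _ _ _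
    (heis_class_expgz _ _ _ _ a rho_h1) (heis_class_expgz _ _ _ _ b rho_h2))).
  (* The parameters of the image are [b - 2 a] and [- b - 2 a]; their difference is [2 b] and their
     sum is [- 4 a]. *)
  apply: contra ab => /eqP[e1 e2].
  have /eqP : (b%:~R * 2 = 0 :> R[i])%R.
    rewrite -[RHS](subrr 0%R) -[X in _ = (X - _)%R]e1.
    by rewrite -[X in _ = (_ - X)%R]e2; ring.
  have /eqP : (a%:~R * 4 = 0 :> R[i])%R.
    rewrite -[RHS]oppr0 -[X in _ = (- X)%R]addr0.
    by rewrite -[X in _ = (- (X + _))%R]e1 -[X in _ = (- (_ + X))%R]e2; ring.
  rewrite !mulf_eq0 !intr_eq0 !pnatr_eq0 !orbF => /eqP -> /eqP ->.
  by rewrite eqxx.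
(* Injectivity of the composite yields at once that [phi] is injective and that [rho] is faithful on
   its range. *)
have phi_inj u v : rho (phi u) = rho (phi v) -> u = v.
  move=> uv; apply/eqP; rewrite -subr_eq0; apply: contraT => /par.
  have -> : rho (phi (u - v)%R) = 1%g.
    apply: (mulIg (rho (phi v))); rewrite -gmulfM -phiD subrK mul1g.
    exact: uv.
  by move=> /not_parabolic1.
split.
- by exists phi; split=> // u v uv; apply: phi_inj; rewrite uv.
- move=> x y; rewrite -rangeE => /set_mem[u _ <-] /set_mem[v _ <-] /phi_inj ->.
  by [].
- move=> x; rewrite -rangeE => /set_mem[u _ <-] u1; apply: par.
  by apply/eqP => u0; apply: u1; rewrite u0.
Qed.
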